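(* Let $Q$ be a finite-dimensional real vector space, $L_{\mathrm{d}}:Q\times Q\to\mathbb{R}$ a smooth discrete Lagrangian, $\Delta_Q\subset TQ$ a constraint distribution of constant rank with annihilator $\Delta_Q^\circ\subset T^*Q$, $\Delta_Q^{\mathrm{d}\pm}\subset Q\times Q$ the associated discrete constraint distributions, and $N\ge 1$ an integer. (+) If $\{q_k\}_{k=0}^{N}\subset Q$, $\{q_k^+\}_{k=0}^{N-1}\subset Q$, $\{p_{k+1}\}_{k=0}^{N-1}\subset Q^*$ satisfy the $(+)$-discrete Lagrange--d'Alembert--Pontryagin principle $$\delta\sum_{k=0}^{N-1}\bigl[L_{\mathrm{d}}(q_k,q_k^+)+p_{k+1}(q_{k+1}-q_k^+)\bigr]=0,$$ then they satisfy the $(+)$-discrete Lagrange--Dirac equations $$(q_k,q_{k+1})\in\Delta_Q^{\mathrm{d}+},\qquad q_{k+1}=q_k^+,\qquad p_{k+1}=D_2L_{\mathrm{d}}(q_k,q_k^+)\qquad(0\le k\le N-1),$$ $$p_k+D_1L_{\mathrm{d}}(q_k,q_k^+)\in\Delta_Q^\circ(q_k)\qquad(1\le k\le N-1).$$ (−) If $\{q_k\}_{k=0}^{N}\subset Q$, $\{q_{k+1}^-\}_{k=0}^{N-1}\subset Q$, $\{p_{k}\}_{k=0}^{N-1}\subset Q^*$ satisfy the $(-)$-discrete Lagrange--d'Alembert--Pontryagin principle $$\delta\sum_{k=0}^{N-1}\bigl[L_{\mathrm{d}}(q_{k+1}^-,q_{k+1})-p_{k}(q_{k}-q_{k+1}^-)\bigr]=0,$$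 then they satisfy the $(-)$-discrete Lagrange--Dirac equations $$(q_k,q_{k+1})\in\Delta_Q^{\mathrm{d}-},\qquad q_{k}=q_{k+1}^-,\qquad p_{k}=-D_1L_{\mathrm{d}}(q_{k+1}^-,q_{k+1})\qquad(0\le k\le N-1),$$ $$p_{k+1}-D_2L_{\mathrm{d}}(q_{k+1}^-,q_{k+1})\in\Delta_Q^\circ(q_{k+1})\qquad(0\le k\le N-2).$$
   Context: $T_qQ\cong Q$ and $T_q^*Q\cong Q^*$ since $Q$ is a vector space; $p\,(q)$ denotes the natural pairing of $p\in Q^*$ with $q\in Q$; $D_i$ is the partial derivative with respect to the $i$-th argument, so $D_iL_{\mathrm{d}}$ takes values in $Q^*$. The annihilator of $\Delta_Q$ is $\Delta_Q^\circ(q)=\{\alpha_q\in T_q^*Q\mid\langle\alpha_q,v_q\rangle=0\text{ for all }v_q\in\Delta_Q(q)\}$, spanned by one-forms $\omega^1,\dots,\omega^m$, $m=\dim Q-\dim\Delta_Q(q)$. A retraction on $Q$ is a smooth map $\mathcal{R}:TQ\to Q$ whose restriction $\mathcal{R}_q$ to $T_qQ$ satisfies $\mathcal{R}_q(0_q)=q$ and $T_{0_q}\mathcal{R}_q=\mathrm{id}_{T_qQ}$ for all $q$; $\mathcal{R}_q^{-1}$ is its (local) inverse near $0_q$. With a fixed retraction, put $\omega^a_{\mathrm{d}+}(q_0,q_1):=\omega^a(q_0,\mathcal{R}_{q_0}^{-1}(q_1))$ and $\omega^a_{\mathrm{d}-}(q_0,q_1):=\omega^a(q_1,-\mathcal{R}_{q_1}^{-1}(q_0))$;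 then $\Delta_Q^{\mathrm{d}\pm}:=\{(q_0,q_1)\in Q\times Q\mid\omega^a_{\mathrm{d}\pm}(q_0,q_1)=0,\ a=1,\dots,m\}$. Meaning of the principles: the sequences satisfy the $(\pm)$-discrete Lagrange--d'Alembert--Pontryagin principle if (1) the constraint $(q_k,q_{k+1})\in\Delta_Q^{\mathrm{d}\pm}$ holds for $k=0,\dots,N-1$ (with the sign $+$ or $-$ respectively), and (2) the first variation (the differential of the displayed sum, regarded as a function of all the variables $q_k$, $q_k^+$, $p_{k+1}$, respectively $q_k$, $q_{k+1}^-$, $p_k$, considered independent) vanishes on all variations such that $\delta q_0=\delta q_N=0$ and $\delta q_k\in\Delta_Q(q_k)$ for all $k$, while the variations $\delta q_k^+$, $\delta p_{k+1}$ (respectively $\delta q_{k+1}^-$, $\delta p_k$) are arbitrary. The constraint on $\delta q_k$ is imposed after taking the variations inside the sum (so variations are not required to be tangent to the constraint in (1)). *)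

(* Defs.v *)
From HB Require Import structures.
From mathcomp Require Import all_boot all_order all_algebra.
From mathcomp Require Import all_classical all_reals all_analysis.

Set Implicit Arguments.
Unset Strict Implicit.
Unset Printing Implicit Defensive.

Import Order.TTheory GRing.Theory Num.Theory.
Import numFieldNormedType.Exports.
Import VectorInternalTheory.

Local Open Scope classical_set_scope.
Local Open Scope ring_scope.

(* A [vectType] carries no topology in the library.  Its canonical topology and
   smooth structure are those of the row vectors 'rV[R]_n, transported along
   the linear coordinates [v2r] (inverse [r2v]); they do not depend on the
   choice of linear coordinates. *)
Section FiniteDimensionalCalculus.
Context {R : realType}.
Implicit Types V W : vectType R.

Definition in_coords V W (f : V -> W) : 'rV[R]_(dim V) -> 'rV[R]_(dim W) :=
  v2r \o f \o r2v.

Definition vopen V (A : set V) : Prop :=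
  open ((r2v : 'rV[R]_(dim V) -> V) @^-1` A).

Definition vcontinuous V W (f : V -> W) : Prop := continuous (in_coords f).

Definition vdifferentiable V W (f : V -> W) (x : V) : Prop :=
  differentiable (in_coords f) (v2r x).

Definition vdiff V W (f : V -> W) (x : V) : 'Hom(V, W) :=
  linfun (r2v \o 'd (in_coords f) (v2r x) \o v2r).

Fixpoint vCk (k : nat) V W (f : V -> W) : Prop :=
  if k is k'.+1 then (forall x, vdifferentiable f x) /\ vCk k' (vdiff f)
  else vcontinuous f.

Definition vsmooth V W (f : V -> W) : Prop := forall k, vCk k f.

End FiniteDimensionalCalculus.

Section Geometry.
Context {R : realType}.
Implicit Type Q : vectType R.

Definition annihilator Q (U : {vspace Q}) : set 'Hom(Q, R^o) :=
  [set alpha | forall v, v \in U -> alpha v = 0].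

(* The one-forms [cd_form] are smooth and, the rank being constant, so is the
   distribution, which is the intersection of their kernels. *)
Record constraint_distribution Q := ConstraintDistribution {
  cd_space :> Q -> {vspace Q};
  cd_rank : nat;
  cd_rankP : forall q, \dim (cd_space q) = cd_rank;
  cd_form : 'I_(\dim {:Q} - cd_rank) -> Q -> 'Hom(Q, R^o);
  cd_form_smooth : forall a, vsmooth (cd_form a);
  cd_form_span : forall q,
    annihilator (cd_space q) =
      [set alpha | alpha \in
         <<[seq cd_form a q | a : 'I_(\dim {:Q} - cd_rank)]>>%VS]
}.

(* TQ is Q * Q, the pair (q, v) standing for the vector v of T_q Q. *)
Record retraction Q := Retraction {
  retr :> Q * Q -> Q;
  retr_smooth : vsmooth retr;
  retr0 : forall q, retr (q, 0) = q;
  retr_diff0 : forall q, vdiff (fun v => retr (q, v)) 0 = \1%VF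
}.

(* [U q] is an open neighbourhood of the origin of T_q Q which the retraction
   at q maps diffeomorphically onto its image: it is injective there, with
   invertible differential at each point. *)
Definition inversion_domain Q (rho : retraction Q) (U : Q -> set Q) : Prop :=
  forall q, [/\ vopen (U q), U q 0,
    {in U q &, injective (fun v => rho (q, v))} &
    forall v, U q v -> lker (vdiff (fun w => rho (q, w)) v) = 0%VS].

(* The local inverse of the retraction at [q], with values in [U q]; it is
   meaningful only on the image of [U q]. *)
Definition retr_inv Q (rho : retraction Q) (U : Q -> set Q) (q q' : Q) : Q :=
  xget 0 [set v | U q v /\ rho (q, v) = q'].

Section DiscreteConstraint.
Variables (Q : vectType R) (Delta : constraint_distribution Q).
Variables (rho : retraction Q) (U : Q -> set Q).

Definition form_dplus a (q0 q1 : Q) : R :=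
  cd_form (c := Delta) a q0 (retr_inv rho U q0 q1).

Definition form_dminus a (q0 q1 : Q) : R :=
  cd_form (c := Delta) a q1 (- retr_inv rho U q1 q0).

(* The first conjunct says that the discrete one-forms are defined at the
   pair (q0, q1), the retraction being only locally invertible. *)
Definition Delta_dplus : set (Q * Q) :=
  [set x | ((fun v => rho (x.1, v)) @` U x.1) x.2 /\
           forall a, form_dplus a x.1 x.2 = 0].

Definition Delta_dminus : set (Q * Q) :=
  [set x | ((fun v => rho (x.2, v)) @` U x.2) x.1 /\
           forall a, form_dminus a x.1 x.2 = 0].

End DiscreteConstraint.
End Geometry.

Section Mechanics.
Context {R : realType} {Q : vectType R}.
Implicit Type L : Q * Q -> R^o.

Definition D1 L (x : Q * Q) : 'Hom(Q, R^o) := vdiff (fun q => L (q, x.2)) x.1.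
Definition D2 L (x : Q * Q) : 'Hom(Q, R^o) := vdiff (fun q => L (x.1, q)) x.2.

Context {N : nat}.

(* For k < N, the indices k and k.+1 of a sequence q_0, ..., q_N. *)
Definition cur (k : 'I_N) : 'I_N.+1 := widen_ord (leqnSn N) k.
Definition nxt (k : 'I_N) : 'I_N.+1 := lift ord0 k.

(* Triples of sequences (q, r, p).  In the (+) case [r k] is q_k^+ and [p k] is
   p_{k+1}; in the (-) case [r k] is q_{k+1}^- and [p k] is p_k. *)
Definition path_space : vectType R :=
  ({ffun 'I_N.+1 -> Q} * {ffun 'I_N -> Q} * {ffun 'I_N -> 'Hom(Q, R^o)})%type.

Definition action_plus L (z : path_space) : R^o :=
  let: (q, qp, p) := z in
  \sum_(k < N) (L (q (cur k), qp k) + p k (q (nxt k) - qp k)).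

Definition action_minus L (z : path_space) : R^o :=
  let: (q, qm, p) := z in
  \sum_(k < N) (L (qm k, q (nxt k)) - p k (q (cur k) - qm k)).

Definition admissible (Delta : constraint_distribution Q)
    (q dq : {ffun 'I_N.+1 -> Q}) : Prop :=
  [/\ dq ord0 = 0, dq ord_max = 0 & forall k, dq k \in Delta (q k)].

Variables (L : Q * Q -> R^o) (Delta : constraint_distribution Q).
Variables (rho : retraction Q) (U : Q -> set Q).

Definition LdAP_plus (q : {ffun 'I_N.+1 -> Q}) (qp : {ffun 'I_N -> Q})
    (p : {ffun 'I_N -> 'Hom(Q, R^o)}) : Prop :=
  (forall k, Delta_dplus Delta rho U (q (cur k), q (nxt k))) /\
  (forall dq dqp dp, admissible Delta q dq ->
     vdiff (action_plus L) (q, qp, p) (dq, dqp, dp) = 0).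

Definition LdAP_minus (q : {ffun 'I_N.+1 -> Q}) (qm : {ffun 'I_N -> Q})
    (p : {ffun 'I_N -> 'Hom(Q, R^o)}) : Prop :=
  (forall k, Delta_dminus Delta rho U (q (cur k), q (nxt k))) /\
  (forall dq dqm dp, admissible Delta q dq ->
     vdiff (action_minus L) (q, qm, p) (dq, dqm, dp) = 0).

(* In the last clause [p j], with k = j.+1, is p_k: here 1 <= k <= N - 1. *)
Definition Lagrange_Dirac_plus (q : {ffun 'I_N.+1 -> Q})
    (qp : {ffun 'I_N -> Q}) (p : {ffun 'I_N -> 'Hom(Q, R^o)}) : Prop :=
  (forall k : 'I_N,
     [/\ Delta_dplus Delta rho U (q (cur k), q (nxt k)),
         q (nxt k) = qp k &
         p k = D2 L (q (cur k), qp k)]) /\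
  (forall j k : 'I_N, k = j.+1 :> nat ->
     annihilator (Delta (q (cur k))) (p j + D1 L (q (cur k), qp k))).

(* In the last clause [p j], with j = k.+1, is p_{k+1}: here 0 <= k <= N - 2. *)
Definition Lagrange_Dirac_minus (q : {ffun 'I_N.+1 -> Q})
    (qm : {ffun 'I_N -> Q}) (p : {ffun 'I_N -> 'Hom(Q, R^o)}) : Prop :=
  (forall k : 'I_N,
     [/\ Delta_dminus Delta rho U (q (cur k), q (nxt k)),
         q (cur k) = qm k &
         p k = - D1 L (qm k, q (nxt k))]) /\
  (forall k j : 'I_N, j = k.+1 :> nat ->
     annihilator (Delta (q (nxt k))) (p j - D2 L (qm k, q (nxt k)))).

End Mechanics.

(* Main.v *)
(* Both actions are sums of terms
   L(q_s, r) + c p (q_t - r), where (s, t, c) is (k, k+1, 1) for the principle (+)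
   and, after exchanging the arguments of L, (k+1, k, -1) for (-).  Varying p alone
   gives q_t = r, since covectors separate points; varying r alone gives
   D_2 L = c p; and varying one interior q_k = q_s = q_{t'} within Delta gives
   c p' + D_1 L in the annihilator of Delta.  The discrete constraint is part of
   the principle itself. *)
From HB Require Import structures.
Require Import Defs.
From mathcomp Require Import all_boot all_order all_algebra.
From mathcomp Require Import all_classical all_reals all_analysis.

Set Implicit Arguments.
Unset Strict Implicit.
Unset Printing Implicit Defensive.

Import GRing.Theory.
Import numFieldNormedType.Exports.
Import VectorInternalTheory.

Local Open Scope ring_scope.

(** * Differentiability of linear maps on row vectors *)

Section LinearMaps.
Context {R : realType}.

(** Expanding the argument in the standard basis makes [f] a finite sum of coordinate functions
    times fixed vectors. *)
Lemma differentiable_linear_rV n (W : normedModType R)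
    (f : {linear 'rV[R]_n -> W}) x : differentiable f x.
Proof.
rewrite (_ : (f : _ -> _) =
    \sum_(i < n) (fun y : 'rV[R]_n => y 0 i *: f (delta_mx 0 i))).
  apply: differentiable_sum => i.
  exact/differentiableZl/differentiable_coord.
apply/funext => y; rewrite fct_sumE {1}[y]row_sum_delta linear_sum.
by apply: eq_bigr => i _; rewrite linearZ.
Qed.

Lemma is_diff_linear_rV n (W : normedModType R)
    (f : {linear 'rV[R]_n -> W}) x : is_diff x f f.
Proof.
apply: DiffDef; first exact: differentiable_linear_rV.
by apply: diff_lin => y; exact/differentiable_continuous/differentiable_linear_rV.
Qed.

End LinearMaps.

(** * Rules of differentiation on vector spaces, read in coordinates *)

Section Calculus.
Context {R : realType}.
Implicit Types V W X : vectType R.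

(** The differential [l] is a bare function, so that the rules below produce explicit formulas
    without a linear map being built at each step; its linearity is implied by [is_diff]. *)
Definition is_vdiff V W (f : V -> W) (x : V) (l : V -> W) : Prop :=
  is_diff (v2r x) (in_coords f) (in_coords l).

Lemma is_vdiff_val V W (f : V -> W) x l v : is_vdiff f x l -> vdiff f x v = l v.
Proof. by case=> _ dE; rewrite lfunE /= dE /in_coords /= !v2rK. Qed.

Lemma vdifferentiable_is_vdiff V W (f : V -> W) x :
  vdifferentiable f x -> is_vdiff f x (vdiff f x).
Proof.
move=> fx; apply: DiffDef => //.
by apply/funext => v; rewrite /in_coords /= lfunE /= !r2vK.
Qed.

Lemma is_vdiff_linear V W (f : V -> W) x : linear f -> is_vdiff f x f.
Proof.
(* Linearity is given as a proposition and has to be packed into a structure before the result on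
   row vectors applies. *)
move=> lf; pose fL := GRing.isLinear.Build _ _ _ _ f lf.
pose g : {linear V -> W} := HB.pack f fL.
exact: (is_diff_linear_rV (v2r \o g \o r2v)).
Qed.

Lemma is_vdiff_cst V W (a : W) (x : V) : is_vdiff (fun=> a) x (fun=> 0).
Proof.
rewrite /is_vdiff (_ : in_coords (fun=> 0 : W) = 0).
  exact: (is_diff_cst (v2r a)).
by apply/funext => y; rewrite /in_coords /= linear0.
Qed.

Lemma is_vdiffD V W (f g : V -> W) x df dg :
  is_vdiff f x df -> is_vdiff g x dg ->
  is_vdiff (fun z => f z + g z) x (fun h => df h + dg h).
Proof.
have E (u v : V -> W) : in_coords (fun z => u z + v z) = in_coords u + in_coords v.
  by apply/funext => y; rewrite /in_coords /= linearD.
by move=> fx gx; rewrite /is_vdiff !E; exact: is_diffD.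
Qed.

Lemma is_vdiff_sum V W n (f df : 'I_n -> V -> W) x :
  (forall i, is_vdiff (f i) x (df i)) ->
  is_vdiff (fun z => \sum_i f i z) x (fun h => \sum_i df i h).
Proof.
elim: n f df => [|n IH] f df fx.
  rewrite (_ : (fun z => _) = fun=> 0); last by apply/funext => z; rewrite big_ord0.
  rewrite (_ : (fun h => _) = fun=> 0); last by apply/funext => z; rewrite big_ord0.
  exact: is_vdiff_cst.
have E (g : 'I_n.+1 -> V -> W) :
    (fun z => \sum_i g i z) = fun z => g ord0 z + \sum_i g (lift ord0 i) z.
  by apply/funext => z; rewrite big_ord_recl.
by rewrite !E; apply: is_vdiffD => //; apply: IH.
Qed.

Lemma is_vdiff_comp V W X (f : V -> W) (g : W -> X) x df dg :
  is_vdiff f x df -> is_vdiff g (f x) dg ->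
  is_vdiff (g \o f) x (dg \o df).
Proof.
have E (u : V -> W) (v : W -> X) : in_coords (v \o u) = in_coords v \o in_coords u.
  by apply/funext => y; rewrite /in_coords /= v2rK.
move=> fx gx; rewrite /is_vdiff !E; apply: is_diff_comp => //.
by rewrite [in_coords f (v2r x)]/in_coords /= v2rK.
Qed.

(** In coordinates the values are row vectors, which cannot be multiplied. They are first read back
    as scalars, the product rule is used in [R], and [v2r] returns to coordinates. *)
Lemma is_vdiffM V (f g df dg : V -> R^o) x :
  is_vdiff f x df -> is_vdiff g x dg ->
  is_vdiff (fun z => f z * g z) x (fun h => f x * dg h + g x * df h).
Proof.
have S (u du : V -> R^o) : is_vdiff u x du ->
    is_diff (v2r x) (u \o r2v : _ -> R) (du \o r2v : _ -> R).
  have E (w : V -> R^o) : (w \o r2v : _ -> R) = (r2v : 'rV[R]_(dim R^o) -> R^o) \o in_coords w.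
    by apply/funext => y; rewrite /in_coords /= v2rK.
  move=> ux; rewrite !E; apply: is_diff_comp => //.
  exact: (is_diff_linear_rV (r2v : {linear 'rV[R]_(dim R^o) -> R^o})).
move=> /S fx /S gx.
have fgx := is_diffM fx gx.
(* On the line, [v2r] is scaling of one fixed vector, hence differentiable and its own
   differential. *)
have vE : (v2r : R^o -> 'rV[R]_(dim R^o)) = *:%R^~ (v2r (1 : R^o)).
  by apply/funext => a; rewrite -linearZ /= [_ *: _]mulr1.
have vx y : is_diff (y : R) (v2r : R^o -> 'rV[R]_(dim R^o)) v2r.
  by rewrite vE; exact: is_diff_scalel.
have := is_diff_comp fgx (vx _); rewrite /is_vdiff.
set u := (X in is_diff _ X _); set du := (X in is_diff _ _ X).
rewrite (_ : u = in_coords (fun z => f z * g z)) //.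
rewrite (_ : du = in_coords (fun h => f x * dg h + g x * df h)) //.
by apply/funext => y; rewrite /du /in_coords /= v2rK.
Qed.

(** In a basis of [W] the pairing is a finite sum of products of scalar functions, each linear in
    [f z] or in [p z]; the product rule applies term by term. *)
Lemma is_vdiff_pairing V W (p dp : V -> 'Hom(W, R^o)) (f df : V -> W) x :
  is_vdiff p x dp -> is_vdiff f x df ->
  is_vdiff (fun z => p z (f z)) x (fun h => p x (df h) + dp h (f x)).
Proof.
move=> px fx; pose e := vbasis {:W}.
have eE (a : 'Hom(W, R^o)) w : a w = \sum_i coord e i w * a e`_i.
  rewrite {1}(coord_vbasis (memvf w)) linear_sum.
  by apply: eq_bigr => i _; rewrite linearZ.
pose F i z : R^o := coord e i (f z) * p z e`_i.
pose dF i h : R^o := coord e i (f x) * dp h e`_i + p x e`_i * coord e i (df h).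
rewrite (_ : (fun h => p x _ + _) = fun h => \sum_i dF i h); last first.
  apply/funext => h; rewrite big_split /= addrC (eE (dp h)) (eE (p x)); congr (_ + _).
  by apply: eq_bigr => i _; rewrite mulrC.
rewrite (_ : (fun z => p z _) = fun z => \sum_i F i z); last first.
  by apply/funext => z; rewrite eE.
apply: is_vdiff_sum => i; apply: is_vdiffM.
  apply: (is_vdiff_comp (g := coord e i : W -> R^o) fx).
  by apply: is_vdiff_linear => k u v; rewrite linearP.
apply: (is_vdiff_comp (g := fun a : 'Hom(W, R^o) => a e`_i) (dg := fun a => a e`_i) px).
by apply: is_vdiff_linear => k u v; rewrite add_lfunE scale_lfunE.
Qed.

End Calculus.

(** * First variation and stationary points of the common form of both actions *)

Section Pontryagin.
Context {R : realType} {Q : vectType R}.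
Variable L : Q * Q -> R^o.
Hypothesis diffL : forall x, vdifferentiable L x.

(** Chain rule along the two slices through [x], each written as a linear inclusion plus a
    constant. *)
Lemma vdiff_partial x u v : vdiff L x (u, v) = D1 L x u + D2 L x v.
Proof.
case: x => a b; have Lx := vdifferentiable_is_vdiff (diffL (a, b)).
have -> : (u, v) = (u, 0) + (0, v) :> Q * Q.
  by congr pair; rewrite /= ?addr0 ?add0r.
rewrite linearD; congr (_ + _).
- have ix : is_vdiff (fun q : Q => (q, 0) + (0, b) : Q * Q) a (fun h => (h, 0) + 0).
    apply: is_vdiffD; last exact: is_vdiff_cst.
    by apply: is_vdiff_linear => k y z; congr pair; rewrite /= scaler0 addr0.
  rewrite (_ : (fun q : Q => _) = fun q => (q, b)) in ix; last first.
    by apply/funext => q; congr pair; rewrite /= ?addr0 ?add0r.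
  by rewrite /D1 (is_vdiff_val u (is_vdiff_comp ix Lx)) /= addr0.
- have ix : is_vdiff (fun q : Q => (0, q) + (a, 0) : Q * Q) b (fun h => (0, h) + 0).
    apply: is_vdiffD; last exact: is_vdiff_cst.
    by apply: is_vdiff_linear => k y z; congr pair; rewrite /= scaler0 addr0.
  rewrite (_ : (fun q : Q => _) = fun q => (a, q)) in ix; last first.
    by apply/funext => q; congr pair; rewrite /= ?addr0 ?add0r.
  by rewrite /D2 (is_vdiff_val v (is_vdiff_comp ix Lx)) /= addr0.
Qed.

Context {N : nat}.
Variables (c : R) (s t : 'I_N -> 'I_N.+1).

Definition pontryagin_action (z : @path_space R Q N) : R^o :=
  \sum_(k < N) (L (z.1.1 (s k), z.1.2 k) + c * z.2 k (z.1.1 (t k) - z.1.2 k)).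

Lemma vdiff_pontryagin q r p dq dr dp :
  vdiff pontryagin_action (q, r, p) (dq, dr, dp) =
  \sum_(k < N) (D1 L (q (s k), r k) (dq (s k)) + D2 L (q (s k), r k) (dr k)
    + c * (p k (dq (t k) - dr k) + dp k (q (t k) - r k))).
Proof.
pose d (k : 'I_N) (h : @path_space R Q N) : R^o :=
  vdiff L (q (s k), r k) (h.1.1 (s k), h.1.2 k)
  + c * (p k (h.1.1 (t k) - h.1.2 k) + h.2 k (q (t k) - r k)).
have dP : is_vdiff pontryagin_action (q, r, p) (fun h => \sum_k d k h).
  apply: is_vdiff_sum => k; apply: is_vdiffD.
    apply: (is_vdiff_comp (f := fun z : path_space => (z.1.1 (s k), z.1.2 k))
      (df := fun z : path_space => (z.1.1 (s k), z.1.2 k))).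
      by apply: is_vdiff_linear => a y z; congr pair; rewrite !ffunE.
    exact/vdifferentiable_is_vdiff.
  (* The factor [c] is treated as a linear map composed with the pairing. *)
  rewrite -[X in is_vdiff X](_ : ( *:%R c : R^o -> R^o) \o
    (fun z : path_space => z.2 k (z.1.1 (t k) - z.1.2 k)) = _) //.
  apply: (is_vdiff_comp (dg := *:%R c : R^o -> R^o)); last first.
    by apply: is_vdiff_linear => a y z; rewrite scalerDr !scalerA mulrC.
  apply: (is_vdiff_pairing (p := fun z : path_space => z.2 k)
      (dp := fun z : path_space => z.2 k)
      (f := fun z : path_space => z.1.1 (t k) - z.1.2 k)).
    by apply: is_vdiff_linear => a y z; rewrite !ffunE.
  apply: is_vdiff_linear => a y z; rewrite !ffunE.
  by rewrite scalerBr opprD addrACA.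
rewrite (is_vdiff_val _ dP); apply: eq_bigr => k _.
by rewrite /d /= vdiff_partial.
Qed.

Hypothesis s_inj : injective s.
Hypothesis t_inj : injective t.
Hypothesis c_neq0 : c != 0.

Variable Delta : constraint_distribution Q.
Variables (q : {ffun 'I_N.+1 -> Q}) (r : {ffun 'I_N -> Q}).
Variable p : {ffun 'I_N -> 'Hom(Q, R^o)}.
Hypothesis stationary : forall dq dr dp, admissible Delta q dq ->
  vdiff pontryagin_action (q, r, p) (dq, dr, dp) = 0.

(* Stated for abstract covectors: on the summands of [vdiff_pontryagin] themselves
   these rewrites diverge, by unfolding [D1] and [D2]. *)
Let vary_p (a b m l : 'Hom(Q, R^o)) w :
  a 0 + b 0 + c * (m (0 - 0) + l w) = c * l w.
Proof. by rewrite subr0 !linear0 !add0r. Qed.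

Let vary_r (a b m : 'Hom(Q, R^o)) v w :
  a 0 + b v + c * (m (0 - v) + (0 : 'Hom(Q, R^o)) w) = (b - c *: m) v.
Proof.
rewrite zero_lfunE linear0 add0r addr0 sub0r linearN mulrN.
by rewrite add_lfunE opp_lfunE scale_lfunE.
Qed.

Let vary_q (a b m : 'Hom(Q, R^o)) u v w :
  a u + b 0 + c * (m (v - 0) + (0 : 'Hom(Q, R^o)) w) = a u + (c *: m) v.
Proof. by rewrite zero_lfunE linear0 !addr0 subr0 scale_lfunE. Qed.

Lemma admissible0 : admissible Delta q 0.
Proof. by split=> [||k]; rewrite ffunE // mem0v. Qed.

Lemma stationary_position k : q (t k) = r k.
Proof.
apply/eqP; rewrite -subr_eq0; apply/eqP; set w := _ - _.
have aw (a : 'Hom(Q, R^o)) : a w = 0.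
  (* Only the [k]-th covector varies, in an arbitrary direction [a]; the sum reduces to
     [c * a w]. *)
  pose dp : {ffun 'I_N -> 'Hom(Q, R^o)} := [ffun j => if j == k then a else 0].
  have := stationary 0 dp admissible0; rewrite vdiff_pontryagin.
  rewrite (eq_bigr (fun j => c * dp j (q (t j) - r j))) => [|j _]; last first.
    by rewrite ![(0 : {ffun _}) _]ffunE; exact: vary_p.
  rewrite (bigD1 k) //= big1 => [|j /negPf jk]; last first.
    by rewrite ffunE jk zero_lfunE mulr0.
  rewrite ffunE eqxx addr0 => /eqP.
  by rewrite mulf_eq0 (negPf c_neq0) => /eqP.
(* Taking for [a] the coordinate forms of a basis shows that every coordinate of [w] is zero. *)
rewrite (coord_vbasis (memvf w)) big1 // => i _.
have := aw (linfun (coord (vbasis fullv) i : Q -> R^o)).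
by rewrite lfunE /= => ->; rewrite scale0r.
Qed.

Lemma stationary_momentum k : D2 L (q (s k), r k) = c *: p k.
Proof.
apply/eqP; rewrite -subr_eq0; apply/eqP/lfunP => w; rewrite zero_lfunE.
pose dr : {ffun 'I_N -> Q} := [ffun j => if j == k then w else 0].
have := stationary dr 0 admissible0; rewrite vdiff_pontryagin.
rewrite (eq_bigr (fun j => (D2 L (q (s j), r j) - c *: p j) (dr j))) => [|j _]; last first.
  by rewrite ![(0 : {ffun _}) _]ffunE; exact: vary_r.
rewrite (bigD1 k) //= big1 => [|j /negPf jk]; last first.
  by rewrite ffunE jk; exact: linear0.
by rewrite ffunE eqxx addr0.
Qed.

(** The node [s k = t j] enters summand [k] through [L] and summand [j] through the pairing. Being
    interior, it may vary alone within [Delta]. *)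
Lemma stationary_annihilator j k : s k = t j -> s k != ord0 -> s k != ord_max ->
  annihilator (Delta (q (s k))) (c *: p j + D1 L (q (s k), r k)).
Proof.
move=> skj s0 sm v vD.
pose dq : {ffun 'I_N.+1 -> Q} := [ffun i => if i == s k then v else 0].
have dqA : admissible Delta q dq.
  split=> [||i]; rewrite ffunE 1?eq_sym ?(negPf s0) ?(negPf sm) //.
  by case: eqP => [<-|_] //; rewrite mem0v.
have := stationary 0 0 dqA; rewrite vdiff_pontryagin.
rewrite (eq_bigr (fun i => D1 L (q (s i), r i) (dq (s i)) + (c *: p i) (dq (t i))));
  last first.
  by move=> i _; rewrite ![(0 : {ffun _}) _]ffunE; exact: vary_q.
(* Injectivity of [s] leaves only term [k] in the first sum; that of [t] leaves only term [j] in the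
   second. *)
rewrite big_split /= (bigD1 k) //= [X in _ + X + _]big1 => [|i ik]; last first.
  by rewrite ffunE (inj_eq s_inj) (negPf ik); exact: linear0.
rewrite (bigD1 j) //= [X in _ + (_ + X)]big1 => [|i ij]; last first.
  by rewrite ffunE skj (inj_eq t_inj) (negPf ij); exact: linear0.
by rewrite !ffunE -skj eqxx !addr0 add_lfunE addrC.
Qed.

End Pontryagin.

(** * Indices of consecutive nodes *)

Lemma cur_inj N : injective (@cur N).
Proof. by move=> i j /(congr1 val) /= ij; apply: val_inj. Qed.

Lemma nxt_inj N : injective (@nxt N).
Proof. exact: lift_inj. Qed.

Lemma cur_neq_max N (k : 'I_N) : cur k != ord_max.
Proof. by rewrite -val_eqE /= neq_ltn ltn_ord. Qed.

(** Identifies the node shared by adjacent summands. It is interior, since [nxt] never takes the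
    value 0 and [cur] never the value [N]. *)
Lemma nxt_cur N (j k : 'I_N) : k = j.+1 :> nat -> nxt j = cur k.
Proof. by move=> kj; apply: val_inj; rewrite /= kj. Qed.

(** * Specialization to the two principles *)

Section LagrangeDirac.
Context {R : realType} {Q : vectType R}.
Variables (L : Q * Q -> R^o) (Delta : constraint_distribution Q).
Variables (rho : retraction Q) (U : Q -> set Q) (N : nat).
Hypothesis diffL : forall x, vdifferentiable L x.

Lemma LdAP_plus_Lagrange_Dirac (q : {ffun 'I_N.+1 -> Q}) (qp : {ffun 'I_N -> Q})
    (p : {ffun 'I_N -> 'Hom(Q, R^o)}) :
  LdAP_plus L Delta rho U q qp p -> Lagrange_Dirac_plus L Delta rho U q qp p.
Proof.
move=> [constr stat].
have actE : @action_plus R Q N L = pontryagin_action L 1 (@cur N) (@nxt N).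
  by apply/funext => -[[x y] z]; apply: eq_bigr => k _; rewrite mul1r.
rewrite actE in stat.
have c1 : (1 : R) != 0 by exact: oner_neq0.
split=> [k|j k kj].
  split=> //; first exact: (stationary_position diffL c1 stat).
  by rewrite (stationary_momentum diffL stat) scale1r.
rewrite -[p j]scale1r.
apply: (stationary_annihilator diffL (@cur_inj N) (@nxt_inj N) stat).
- by rewrite (nxt_cur kj).
- by rewrite -(nxt_cur kj).
- exact: cur_neq_max.
Qed.

Lemma LdAP_minus_Lagrange_Dirac (q : {ffun 'I_N.+1 -> Q}) (qm : {ffun 'I_N -> Q})
    (p : {ffun 'I_N -> 'Hom(Q, R^o)}) :
  LdAP_minus L Delta rho U q qm p -> Lagrange_Dirac_minus L Delta rho U q qm p.
Proof.
move=> [constr stat]; pose L' (x : Q * Q) : R^o := L (x.2, x.1).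
have diffL' x : vdifferentiable L' x.
  have sw : is_vdiff (fun z : Q * Q => (z.2, z.1)) x (fun z => (z.2, z.1)).
    exact: is_vdiff_linear.
  by have [] := is_vdiff_comp sw (vdifferentiable_is_vdiff (diffL _)).
have actE : @action_minus R Q N L = pontryagin_action L' (-1) (@nxt N) (@cur N).
  by apply/funext => -[[x y] z]; apply: eq_bigr => k _; rewrite mulN1r.
rewrite actE in stat.
have c1 : (-1 : R) != 0 by rewrite oppr_eq0 oner_neq0.
split=> [k|k j jk].
  split=> //; first exact: (stationary_position diffL' c1 stat).
  (* Swapping the arguments exchanges the partial derivatives up to conversion. *)
  by rewrite -[D1 L _]/(D2 L' (q (nxt k), qm k))
    (stationary_momentum diffL' stat) scaleN1r opprK.
(* With [c = -1] the covector obtained is the opposite of the desired one; the sign is changed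
   afterwards. *)
have ann : annihilator (Delta (q (nxt k))) (-1 *: p j + D2 L (qm k, q (nxt k))).
  apply: (stationary_annihilator diffL' (@nxt_inj N) (@cur_inj N) stat).
  - exact: nxt_cur.
  - by [].
  - by rewrite (nxt_cur jk) cur_neq_max.
move=> v /ann; rewrite scaleN1r -[- p j + _]opprK opprD opprK.
by rewrite opp_lfunE => /eqP; rewrite oppr_eq0 => /eqP.
Qed.

End LagrangeDirac.

Theorem proposition8p3 (R : realType) (Q : vectType R) (L : Q * Q -> R^o)
    (Delta : constraint_distribution Q) (rho : retraction Q) (U : Q -> set Q)
    (N : nat) :
  vsmooth L -> inversion_domain rho U -> (1 <= N)%N ->
  (forall (q : {ffun 'I_N.+1 -> Q}) (qp : {ffun 'I_N -> Q})
          (p : {ffun 'I_N -> 'Hom(Q, R^o)}),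
     LdAP_plus L Delta rho U q qp p ->
     Lagrange_Dirac_plus L Delta rho U q qp p) /\
  (forall (q : {ffun 'I_N.+1 -> Q}) (qm : {ffun 'I_N -> Q})
          (p : {ffun 'I_N -> 'Hom(Q, R^o)}),
     LdAP_minus L Delta rho U q qm p ->
     Lagrange_Dirac_minus L Delta rho U q qm p).
Proof.
(* Smoothness at order 1 provides differentiability of [L] at every point. *)
move=> smoothL _ _; have [diffL _] := smoothL 1%N.
by split=> *; [exact: LdAP_plus_Lagrange_Dirac | exact: LdAP_minus_Lagrange_Dirac].
Qed.
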